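(* Let $u$ be a normalized and convex weight. (i) There exists $B\ge1$ such that for all $t\ge0$: $u(t)\le\widetilde u(t)\le B\,u(t)^{1/2}$; i.e. $\widetilde u\preceq u\preceq^{\mathfrak c}\widetilde u$. Thus $u\sim^{\mathfrak c}\widetilde u$ holds. (ii) If in addition $u$ is of moderate growth, then there exist $B,H\ge1$ such that for all $t\ge0$: $u(t)\le\widetilde u(t)\le B\,u(t/H)$; i.e. $\widetilde u\preceq u\preceq_{\mathfrak c}\widetilde u$. Thus $u\sim_{\mathfrak c}\widetilde u$ holds.
   Context: A weight is a continuous, non-increasing function $v:[0,+\infty)\to(0,+\infty)$ with $\lim_{t\to+\infty}t^kv(t)=0$ for all $k\ge0$. It is normalized if $v(t)=1$ for all $t\in[0,1]$; convex if $t\mapsto-\log(v(e^t))$ is convex on $\mathbb{R}$; of moderate growth if there is $H\ge1$ with $v(Ht)\le e^Hv(t)^2$ for all $t\ge0$. $H(\mathbb{C})$ is the space of entire functions. For a weight $v$ put $B_{w_v}(\mathbb{C}):=\{f\in H(\mathbb{C}):|f(z)|\le 1/v(|z|)\ \forall z\in\mathbb{C}\}$, $\widetilde{w_v}(z):=\sup\{|f(z)|:f\in B_{w_v}(\mathbb{C})\}$ (a radial function, regarded as a function of $|z|$) and $\widetilde v:=1/\widetilde{w_v}$. For positive functions $v,w$ on $[0,+\infty)$ and $c>0$, let $v_c(t):=v(ct)$ and $v^c(t):=v(t)^c$. Write $v\preceq w$ if there is $C\ge1$ with $w(t)\le Cv(t)$ for all $t\ge0$; $v\preceq_{\mathfrak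 c}w$ if $v\preceq w_c$ for some $c\ge1$; $v\preceq^{\mathfrak c}w$ if $v\preceq w^c$ for some $c\ge1$. Write $v\sim_{\mathfrak c}w$ if $v\preceq_{\mathfrak c}w$ and $w\preceq_{\mathfrak c}v$; $v\sim^{\mathfrak c}w$ if $v\preceq^{\mathfrak c}w$ and $w\preceq^{\mathfrak c}v$. *)

(* Defs.v *)
From Stdlib Require Import Reals Lra.
From Coquelicot Require Import Coquelicot.

Open Scope R_scope.

(** Functions on [0, +oo) are represented by total functions [R -> R]; their
    values at negative arguments are never used. *)

Definition is_weight (v : R -> R) : Prop :=
  continuous_on (fun t => 0 <= t) v /\
  (forall s t, 0 <= s -> s <= t -> v t <= v s) /\
  (forall t, 0 <= t -> 0 < v t) /\
  (forall k : nat, is_lim (fun t => t ^ k * v t) p_infty 0).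

Definition normalized (v : R -> R) : Prop :=
  forall t, 0 <= t <= 1 -> v t = 1.

Definition convex_on_R (phi : R -> R) : Prop :=
  forall x y l, 0 <= l <= 1 ->
    phi (l * x + (1 - l) * y) <= l * phi x + (1 - l) * phi y.

Definition convex_weight (v : R -> R) : Prop :=
  convex_on_R (fun t => - ln (v (exp t))).

Definition moderate_growth (v : R -> R) : Prop :=
  exists H, 1 <= H /\ forall t, 0 <= t -> v (H * t) <= exp H * (v t) ^ 2.

(** Derivatives are taken over the field [C] (not over [R]), so this is
    complex differentiability everywhere. *)
Definition entire (f : C -> C) : Prop :=
  forall z : C, @ex_derive C_AbsRing C_NormedModule f z.

Definition in_ball (v : R -> R) (f : C -> C) : Prop :=
  entire f /\ forall z : C, Cmod (f z) <= 1 / v (Cmod z).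

Definition w_tilde (v : R -> R) (z : C) : R :=
  real (Lub_Rbar (fun x => exists f, in_ball v f /\ x = Cmod (f z))).

(** [w_tilde v] is radial (see [w_tilde_radial]): it is evaluated at the real
    point [t]. *)
Definition v_tilde (v : R -> R) (t : R) : R := 1 / w_tilde v (RtoC t).

Definition dil (v : R -> R) (c : R) : R -> R := fun t => v (c * t).

Definition pow_fun (v : R -> R) (c : R) : R -> R := fun t => Rpower (v t) c.

(** The order is reversed: a larger weight in this sense is a smaller
    function, up to a constant. *)
Definition preceq (v w : R -> R) : Prop :=
  exists K, 1 <= K /\ forall t, 0 <= t -> w t <= K * v t.

Definition preceq_dil (v w : R -> R) : Prop :=
  exists c, 1 <= c /\ preceq v (dil w c).

Definition preceq_pow (v w : R -> R) : Prop :=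
  exists c, 1 <= c /\ preceq v (pow_fun w c).

Definition sim_dil (v w : R -> R) : Prop := preceq_dil v w /\ preceq_dil w v.

Definition sim_pow (v w : R -> R) : Prop := preceq_pow v w /\ preceq_pow w v.

Lemma entire_const (a : C) : entire (fun _ => a).
Proof. intros z; exists zero; apply (@is_derive_const C_AbsRing C_NormedModule). Qed.

Lemma entire_rot (f : C -> C) (a : C) : entire f -> entire (fun z => f (Cmult a z)).
Proof.
intros Hf z; destruct (Hf (Cmult a z)) as [l Hl].
exists (Cmult a l).
assert (Ha : @filterdiff C_AbsRing (AbsRing_NormedModule C_AbsRing)
  (AbsRing_NormedModule C_AbsRing) (fun z => Cmult a z)
  (@locally (AbsRing_NormedModule C_AbsRing) z)
  (fun z => Cmult a z)).
{ apply filterdiff_linear.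
  exact (is_linear_scal_r (K:=C_AbsRing) (V:=AbsRing_NormedModule C_AbsRing) a Cmult_comm). }
refine (@filterdiff_ext_lin C_AbsRing (AbsRing_NormedModule C_AbsRing)
  C_NormedModule _ _ _ _ _
  (@filterdiff_comp' C_AbsRing (AbsRing_NormedModule C_AbsRing)
    (AbsRing_NormedModule C_AbsRing) C_NormedModule
    (fun z => Cmult a z) f z _ _ Ha Hl) _).
intros y; change (Cmult (Cmult a y) l = Cmult y (Cmult a l)); ring.
Qed.

(** [w_tilde] is a genuine supremum: the defining set is nonempty and bounded. *)
Lemma w_tilde_lub (v : R -> R) (z : C) : is_weight v ->
  is_lub (fun x => exists f, in_ball v f /\ x = Cmod (f z)) (w_tilde v z).
Proof.
intros (_ & _ & Hpos & _).
set (E := fun x => _).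
assert (H0 : E 0).
{ exists (fun _ => RtoC 0); split; [split; [apply entire_const|]|].
  - intros y; rewrite Cmod_0; apply Rlt_le, Rdiv_lt_0_compat; [lra|].
    apply Hpos, Cmod_ge_0.
  - now rewrite Cmod_0. }
assert (HE : bound E).
{ exists (1 / v (Cmod z)); intros x (f & [_ Hf] & ->); apply Hf. }
destruct (completeness E HE (ex_intro _ _ H0)) as [m Hm].
unfold w_tilde; fold E.
rewrite (is_lub_Rbar_unique E m); [exact Hm|].
split.
- intros x Hx; exact (proj1 Hm x Hx).
- intros [b| |] Hb; simpl; [|exact I|exact (Hb 0 H0)].
  apply (proj2 Hm); intros x Hx; exact (Hb x Hx).
Qed.

Lemma w_tilde_radial (v : R -> R) (z : C) : w_tilde v z = w_tilde v (RtoC (Cmod z)).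
Proof.
assert (HH : forall (a z : C) x, Cmod a = 1 ->
  (exists f, in_ball v f /\ x = Cmod (f (Cmult a z))) ->
  exists f, in_ball v f /\ x = Cmod (f z)).
{ intros a y x Ha (f & [Hf Hb] & ->).
  exists (fun z => f (Cmult a z)); split; [split|reflexivity].
  - now apply entire_rot.
  - intros t; replace (Cmod t) with (Cmod (Cmult a t)) by (rewrite Cmod_mult, Ha; ring).
    apply Hb. }
unfold w_tilde; f_equal; apply Lub_Rbar_eqset; intros x.
destruct (Ceq_dec z 0) as [->|Hz].
{ now rewrite Cmod_0. }
assert (Hm : Cmod z <> 0) by now apply Rgt_not_eq, Cmod_gt_0.
assert (Hc : RtoC (Cmod z) <> 0) by (intro h; apply Hm; now injection h).
assert (Ha : Cmod (Cdiv z (Cmod z)) = 1).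
{ rewrite Cmod_div, Cmod_R, Rabs_pos_eq; [now field|apply Cmod_ge_0|exact Hc]. }
assert (Hb : Cmod (Cdiv (Cmod z) z) = 1).
{ rewrite Cmod_div, Cmod_R, Rabs_pos_eq; [now field|apply Cmod_ge_0|exact Hz]. }
split; intros H.
- apply (HH (Cdiv z (Cmod z))); [exact Ha|].
  now replace (Cmult (Cdiv z (Cmod z)) (Cmod z)) with z by now field.
- apply (HH (Cdiv (Cmod z) z)); [exact Hb|].
  now replace (Cmult (Cdiv (Cmod z) z) z) with (RtoC (Cmod z)) by now field.
Qed.

(* Main.v *)
Require Import Defs.
From Stdlib Require Import Reals Lra Classical.
From Coquelicot Require Import Coquelicot.
Open Scope R_scope.

(** The bound [u <= v_tilde u] is immediate, since every competitor [f] in the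
    supremum [w_tilde u t] satisfies [|f t| <= 1 / u t].

    For the upper bound one needs an element of the ball that is large at a
    given point.  Monomials suffice.  In logarithmic coordinates
    [phi x = - ln (u (exp x))], the function [phi] is convex, nondecreasing and
    nonnegative, while the monomial [a z^j] becomes the affine function
    [ln a + j x] of slope [j].  A supporting line of [phi] at [x] may have a
    non-integral slope; replacing the slope by its integer part [j] keeps the
    line below [phi] to the right of [x] and lets it exceed [phi] by at most
    [x] between [0] and [x] ([integer_slope_support]).  Lowering the line by [x] thus
    puts it below [phi] everywhere, and in the original coordinates this says
    that a monomial of the ball takes the value [1 / (t u t)] at [t = exp x].
    Hence [v_tilde u t <= t u t] for [t >= 1] ([v_tilde_le_id_mult]).  The
    spurious factor [t] is absorbed by half of the decay of [u]: as [t^2 u t]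
    is bounded, [t] is at most a constant times [(u t)^(-1/2)].

    Moderate growth at [t / H] reads [u t <= e^H (u (t / H))^2], so that the
    square root of [u t] is at most a constant times [u (t / H)]; the second
    part follows from the first. *)

(** * Complex differentiability of monomials *)

(** [C] carries two normed module structures, whose uniform structures are given
    by balls for the modulus and by products of real balls.  A derivative is
    characterised by domination of norms, and both norms are the modulus. *)
Lemma is_derive_C_of_AbsRing (f : C -> C) (z l : C) :
  @is_derive C_AbsRing (AbsRing_NormedModule C_AbsRing) f z l ->
  @is_derive C_AbsRing C_NormedModule f z l.
Proof.
intros [[Hplus Hscal Hnorm] Hdom]; split.
- split; [exact Hplus|exact Hscal|exact Hnorm].
- exact Hdom.
Qed.

Lemma ex_derive_Cpow (n : nat) (z : C) :
  @ex_derive C_AbsRing (AbsRing_NormedModule C_AbsRing) (fun y => Cpow y n) z.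
Proof.
induction n as [|n [l IH]].
- exists zero.
  exact (@is_derive_const C_AbsRing (AbsRing_NormedModule C_AbsRing) (RtoC 1) z).
- eexists.
  apply (@is_derive_mult C_AbsRing (fun y => y) (fun y => Cpow y n) z one l).
  + apply (@is_derive_id C_AbsRing).
  + exact IH.
  + exact Cmult_comm.
Qed.

Lemma entire_monomial (a : C) (n : nat) : entire (fun z => Cmult a (Cpow z n)).
Proof.
intros z; destruct (ex_derive_Cpow n z) as [l Hl].
eexists; apply is_derive_C_of_AbsRing.
apply (@is_derive_mult C_AbsRing (fun _ => a) (fun y => Cpow y n) z zero l).
- apply (@is_derive_const C_AbsRing).
- exact Hl.
- exact Cmult_comm.
Qed.

(** * Supporting lines of integer slope *)

Lemma convex_three_points (phi : R -> R) (x y z : R) :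
  convex_on_R phi -> x < y -> y < z ->
  (z - x) * phi y <= (z - y) * phi x + (y - x) * phi z.
Proof.
intros Hphi Hxy Hyz.
pose proof (Hphi x z ((z - y) / (z - x))) as H.
assert (Hl : 0 <= (z - y) / (z - x) <= 1).
{ split.
  - apply Rlt_le, Rdiv_lt_0_compat; lra.
  - apply -> Rdiv_le_1; lra. }
specialize (H Hl).
replace ((z - y) / (z - x) * x + (1 - (z - y) / (z - x)) * z) with y in H
  by (field; lra).
apply Rmult_le_compat_l with (r := z - x) in H; [|lra].
replace ((z - x) * ((z - y) / (z - x) * phi x + (1 - (z - y) / (z - x)) * phi z))
  with ((z - y) * phi x + (y - x) * phi z) in H by (field; lra).
exact H.
Qed.

Lemma nat_predicate_last (P : nat -> Prop) (N : nat) :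
  P O -> ~ P N -> exists n, P n /\ ~ P (S n).
Proof.
intros H0; induction N as [|N IH]; intros HN; [contradiction|].
destruct (classic (P N)) as [H|H]; [now exists N|now apply IH].
Qed.

(** The natural number [j] is the integer part of the right derivative of [phi]
    at [x], found as the last slope whose line stays below [phi] to the right of
    [x].  The line of slope [j + 1] fails to do so, hence by convexity it lies
    below [phi] to the left of [x]. *)
Lemma integer_slope_support (phi : R -> R) (x : R) :
  convex_on_R phi -> (forall y, x <= y -> phi x <= phi y) ->
  exists j : nat,
    (forall y, x <= y -> phi x + INR j * (y - x) <= phi y) /\
    (forall y, y <= x -> phi x + (INR j + 1) * (y - x) <= phi y).
Proof.
intros Hphi Hmono.
set (P := fun j => forall y, x <= y -> phi x + INR j * (y - x) <= phi y).
destruct (INR_unbounded (phi (x + 1) - phi x)) as [N HN].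
destruct (nat_predicate_last P N) as (j & Hj & HSj).
- intros y Hy; simpl; specialize (Hmono y Hy); lra.
- intros H; specialize (H (x + 1) ltac:(lra)); lra.
- exists j; split; [exact Hj|].
  apply not_all_ex_not in HSj as [z Hz].
  apply imply_to_and in Hz as [Hxz Hz].
  apply Rnot_le_lt in Hz; rewrite S_INR in Hz.
  destruct Hxz as [Hxz|<-]; [|lra].
  intros y [Hy| ->]; [|lra].
  pose proof (convex_three_points phi y x z Hphi Hy Hxz) as H3.
  (* the slope of the chord over [x, z] is below [j + 1] *)
  assert (H : (x - y) * phi z <= (x - y) * (phi x + (INR j + 1) * (z - x)))
    by (apply Rmult_le_compat_l; lra).
  apply Rmult_le_reg_l with (z - x); [lra|].
  nra.
Qed.

(** * Monomials in the ball of a convex weight *)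

Lemma weight_le_1 (u : R -> R) (t : R) :
  is_weight u -> normalized u -> 0 <= t -> u t <= 1.
Proof.
intros (_ & Hdec & _) Hnorm Ht.
rewrite <- (Hnorm 0) by lra; apply Hdec; lra.
Qed.

Lemma in_ball_one (u : R -> R) :
  is_weight u -> normalized u -> in_ball u (fun _ => RtoC 1).
Proof.
intros Hu Hnorm; split; [apply entire_const|].
intros z; rewrite Cmod_1.
pose proof (weight_le_1 u (Cmod z) Hu Hnorm (Cmod_ge_0 z)).
apply Rle_div_r; [apply (proj1 (proj2 (proj2 Hu))), Cmod_ge_0|lra].
Qed.

Lemma exp_nondecreasing (x y : R) : x <= y -> exp x <= exp y.
Proof. intros [H| ->]; [now apply Rlt_le, exp_increasing|lra]. Qed.

(** The monomial is the one whose logarithm is the supporting line of integer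
    slope at [ln t], lowered by [ln t]. *)
Lemma exists_monomial_below (u : R -> R) (t : R) :
  is_weight u -> normalized u -> convex_weight u -> 1 <= t ->
  exists (a : R) (j : nat), 0 < a /\ a * t ^ j = 1 / (t * u t) /\
    forall r, 0 <= r -> a * r ^ j <= 1 / u r.
Proof.
intros (_ & Hdec & Hpos & _) Hnorm Hconv Ht.
pose proof (Hpos t ltac:(lra)) as Hut.
set (phi := fun y => - ln (u (exp y))).
assert (Hinv : forall r, 0 < r -> 1 / u r = exp (phi (ln r))).
{ intros r Hr; unfold phi; rewrite exp_ln, exp_Ropp, exp_ln by (try apply Hpos; lra).
  field; apply Rgt_not_eq, Hpos; lra. }
destruct (integer_slope_support phi (ln t) Hconv) as (j & Hright & Hleft).
{ intros y Hy; unfold phi; apply Ropp_le_contravar, ln_le.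
  - apply Hpos, Rlt_le, exp_pos.
  - apply Hdec; [apply Rlt_le, exp_pos|now apply exp_nondecreasing]. }
set (a := exp (phi (ln t) - ln t - INR j * ln t)).
assert (Hmon : forall r, 0 < r ->
  a * r ^ j = exp (phi (ln t) - ln t + INR j * (ln r - ln t))).
{ intros r Hr; rewrite <- Rpower_pow by exact Hr; unfold a, Rpower.
  rewrite <- exp_plus; f_equal; ring. }
assert (Hln : 0 <= ln t) by (rewrite <- ln_1; apply ln_le; lra).
assert (Hbound : forall r, 1 <= r -> a * r ^ j <= 1 / u r).
{ intros r Hr; rewrite Hmon, Hinv by lra.
  assert (Hlnr : 0 <= ln r) by (rewrite <- ln_1; apply ln_le; lra).
  apply exp_nondecreasing.
  destruct (Rle_lt_dec (ln t) (ln r)) as [H|H].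
  - specialize (Hright _ H); lra.
  - specialize (Hleft _ (Rlt_le _ _ H)); lra. }
exists a, j; split; [apply exp_pos|split].
- rewrite Hmon by lra.
  replace (phi (ln t) - ln t + INR j * (ln t - ln t))
    with (phi (ln t) + - ln t) by ring.
  rewrite exp_plus, <- Hinv, exp_Ropp, exp_ln by lra.
  field; lra.
- intros r Hr; destruct (Rle_lt_dec 1 r) as [H|H]; [now apply Hbound|].
  (* the weight is constant on [0, 1], where the monomial increases *)
  replace (u r) with (u 1) by (rewrite (Hnorm 1), (Hnorm r) by lra; reflexivity).
  apply Rle_trans with (a * 1 ^ j); [|apply Hbound; lra].
  apply Rmult_le_compat_l; [apply Rlt_le, exp_pos|].
  apply pow_incr; lra.
Qed.

(** * Comparison of a weight with its associated weight *)

Lemma w_tilde_ge_1 (u : R -> R) (z : C) :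
  is_weight u -> normalized u -> 1 <= w_tilde u z.
Proof.
intros Hu Hnorm; apply (proj1 (w_tilde_lub u z Hu)).
exists (fun _ => RtoC 1); split; [now apply in_ball_one|now rewrite Cmod_1].
Qed.

Lemma le_v_tilde (u : R -> R) (t : R) :
  is_weight u -> normalized u -> 0 <= t -> u t <= v_tilde u t.
Proof.
intros Hu Hnorm Ht; unfold v_tilde.
pose proof (w_tilde_ge_1 u (RtoC t) Hu Hnorm) as H1.
pose proof (proj1 (proj2 (proj2 Hu)) t Ht) as Hut.
assert (H : w_tilde u (RtoC t) <= 1 / u t).
{ apply (proj2 (w_tilde_lub u (RtoC t) Hu)).
  intros x (f & [_ Hf] & ->).
  specialize (Hf (RtoC t)); now rewrite Cmod_R, Rabs_pos_eq in Hf. }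
apply Rle_div_r; [lra|].
apply Rle_div_r in H; lra.
Qed.

Lemma v_tilde_le_1 (u : R -> R) (t : R) :
  is_weight u -> normalized u -> v_tilde u t <= 1.
Proof.
intros Hu Hnorm; unfold v_tilde.
pose proof (w_tilde_ge_1 u (RtoC t) Hu Hnorm).
apply -> Rdiv_le_1; lra.
Qed.

Lemma v_tilde_le_id_mult (u : R -> R) (t : R) :
  is_weight u -> normalized u -> convex_weight u -> 1 <= t ->
  v_tilde u t <= t * u t.
Proof.
intros Hu Hnorm Hconv Ht.
destruct (exists_monomial_below u t Hu Hnorm Hconv Ht) as (a & j & Ha & Hat & Hbound).
pose proof (proj1 (proj2 (proj2 Hu)) t ltac:(lra)) as Hut.
assert (Hmod : forall z : C, Cmod (Cmult (RtoC a) (Cpow z j)) = a * Cmod z ^ j).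
{ intros z; rewrite Cmod_mult, Cmod_pow, Cmod_R, Rabs_pos_eq by lra; reflexivity. }
assert (Hw : 1 / (t * u t) <= w_tilde u (RtoC t)).
{ apply (proj1 (w_tilde_lub u (RtoC t) Hu)).
  exists (fun z => Cmult (RtoC a) (Cpow z j)); split; [split|].
  - apply entire_monomial.
  - intros z; rewrite Hmod; apply Hbound, Cmod_ge_0.
  - rewrite Hmod, Cmod_R, Rabs_pos_eq by lra; now symmetry. }
pose proof (w_tilde_ge_1 u (RtoC t) Hu Hnorm) as H1.
assert (Htu : 0 < t * u t) by (apply Rmult_lt_0_compat; lra).
unfold v_tilde; apply Rle_div_l; [lra|].
apply Rle_div_l in Hw; lra.
Qed.

Lemma id_mult_sqrt_weight_bounded (u : R -> R) :
  is_weight u -> normalized u ->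
  exists B, 1 <= B /\ forall t, 0 <= t -> t * sqrt (u t) <= B.
Proof.
intros Hu Hnorm.
pose proof (proj2 (proj2 (proj2 Hu)) 2%nat) as Hlim.
apply is_lim_spec in Hlim.
destruct (Hlim (mkposreal 1 Rlt_0_1)) as [T HT]; simpl in HT.
exists (Rmax 1 T); split; [apply Rmax_l|].
intros t Ht.
pose proof (proj1 (proj2 (proj2 Hu)) t Ht) as Hut.
pose proof (weight_le_1 u t Hu Hnorm Ht) as Hut1.
destruct (Rle_lt_dec t T) as [H|H].
- apply Rle_trans with T; [|apply Rmax_r].
  assert (sqrt (u t) <= 1) by (rewrite <- sqrt_1; now apply sqrt_le_1_alt).
  pose proof (sqrt_pos (u t)); nra.
- apply Rle_trans with 1; [|apply Rmax_l].
  specialize (HT t H); apply Rabs_lt_between in HT.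
  pose proof (sqrt_pos (u t)).
  pose proof (sqrt_sqrt (u t) (Rlt_le _ _ Hut)).
  apply Rsqr_incr_0_var; [unfold Rsqr; nra|lra].
Qed.

Lemma v_tilde_le_sqrt (u : R -> R) :
  is_weight u -> normalized u -> convex_weight u ->
  exists B, 1 <= B /\ forall t, 0 <= t -> v_tilde u t <= B * sqrt (u t).
Proof.
intros Hu Hnorm Hconv.
destruct (id_mult_sqrt_weight_bounded u Hu Hnorm) as (B & HB & Hbound).
exists B; split; [exact HB|]; intros t Ht.
destruct (Rle_lt_dec 1 t) as [H|H].
- pose proof (v_tilde_le_id_mult u t Hu Hnorm Hconv H) as Hv.
  pose proof (proj1 (proj2 (proj2 Hu)) t Ht) as Hut.
  rewrite <- (sqrt_sqrt (u t)) in Hv by lra.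
  specialize (Hbound t Ht); pose proof (sqrt_pos (u t)); nra.
- rewrite Hnorm, sqrt_1 by lra.
  pose proof (v_tilde_le_1 u t Hu Hnorm); lra.
Qed.

Lemma sqrt_le_moderate_growth (u : R -> R) (H : R) :
  is_weight u -> 1 <= H ->
  (forall t, 0 <= t -> u (H * t) <= exp H * (u t) ^ 2) ->
  forall t, 0 <= t -> sqrt (u t) <= sqrt (exp H) * u (t / H).
Proof.
intros (_ & _ & Hpos & _) HH Hmg t Ht.
assert (HtH : 0 <= t / H) by (apply Rdiv_le_0_compat; lra).
specialize (Hmg _ HtH); replace (H * (t / H)) with t in Hmg by (field; lra).
rewrite <- (sqrt_pow2 (u (t / H))) by now apply Rlt_le, Hpos.
rewrite <- sqrt_mult_alt by apply Rlt_le, exp_pos.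
now apply sqrt_le_1_alt.
Qed.

Theorem theorem3p7 (u : R -> R) (Hu : is_weight u) (Hnorm : normalized u)
    (Hconv : convex_weight u) :
  ((exists B, 1 <= B /\
      forall t, 0 <= t ->
        u t <= v_tilde u t /\ v_tilde u t <= B * Rpower (u t) (1 / 2)) /\
   preceq (v_tilde u) u /\ preceq_pow u (v_tilde u) /\
   sim_pow u (v_tilde u))
  /\
  (moderate_growth u ->
    (exists B H, 1 <= B /\ 1 <= H /\
       forall t, 0 <= t ->
         u t <= v_tilde u t /\ v_tilde u t <= B * u (t / H)) /\
    preceq (v_tilde u) u /\ preceq_dil u (v_tilde u) /\
    sim_dil u (v_tilde u)).
Proof.
pose proof Hu as (_ & _ & Hpos & _).
assert (Hlow : forall t, 0 <= t -> u t <= v_tilde u t)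
  by (intros t Ht; now apply le_v_tilde).
destruct (v_tilde_le_sqrt u Hu Hnorm Hconv) as (B & HB & Hup).
assert (Hpre : preceq (v_tilde u) u).
{ exists 1; split; [lra|]; intros t Ht; specialize (Hlow t Ht); lra. }
split.
- assert (Hpow : preceq_pow u (v_tilde u)).
  { exists 2; split; [lra|]; exists (B ^ 2); split; [now apply pow_R1_Rle|].
    intros t Ht; unfold pow_fun.
    specialize (Hlow t Ht); specialize (Hup t Ht); specialize (Hpos t Ht).
    replace 2 with (INR 2) by (simpl; lra).
    rewrite Rpower_pow by lra.
    rewrite <- (sqrt_sqrt (u t)) by lra.
    replace (B ^ 2 * (sqrt (u t) * sqrt (u t))) with ((B * sqrt (u t)) ^ 2) by ring.
    apply pow_incr; lra. }
  split; [|split; [exact Hpre|split; [exact Hpow|split; [exact Hpow|]]]].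
  + exists B; split; [exact HB|]; intros t Ht; split; [now apply Hlow|].
    replace (1 / 2) with (/ 2) by lra.
    rewrite Rpower_sqrt by now apply Hpos.
    now apply Hup.
  + exists 1; split; [lra|]; exists 1; split; [lra|].
    intros t Ht; unfold pow_fun; rewrite Rpower_1 by now apply Hpos.
    specialize (Hlow t Ht); lra.
- intros (H & HH & Hmg).
  pose proof (sqrt_le_moderate_growth u H Hu HH Hmg) as Hsqrt.
  set (K := B * sqrt (exp H)).
  assert (HK : 1 <= K).
  { assert (1 <= sqrt (exp H)).
    { rewrite <- sqrt_1; apply sqrt_le_1_alt; rewrite <- exp_0; apply exp_nondecreasing; lra. }
    unfold K; nra. }
  assert (HupH : forall t, 0 <= t -> v_tilde u t <= K * u (t / H)).
  { intros t Ht; apply Rle_trans with (B * sqrt (u t)); [now apply Hup|].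
    unfold K; rewrite Rmult_assoc; apply Rmult_le_compat_l; [lra|now apply Hsqrt]. }
  assert (Hdil : preceq_dil u (v_tilde u)).
  { exists H; split; [exact HH|]; exists K; split; [exact HK|].
    intros t Ht; unfold dil.
    replace (u t) with (u (H * t / H)) by (f_equal; field; lra).
    apply HupH, Rmult_le_pos; lra. }
  split; [|split; [exact Hpre|split; [exact Hdil|split; [exact Hdil|]]]].
  + exists K, H; split; [exact HK|split; [exact HH|]].
    intros t Ht; split; [now apply Hlow|now apply HupH].
  + exists 1; split; [lra|]; exists 1; split; [lra|].
    intros t Ht; unfold dil; rewrite Rmult_1_l.
    specialize (Hlow t Ht); lra.
Qed.
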